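(* Let $\Sigma,\Gamma,\Delta$ be finite alphabets, $\mu,\nu$ probability distributions on $\Sigma,\Gamma$. Let $\delta_1:S\times\Sigma\to S\times\Gamma^*$ and $\delta_2:T\times\Gamma\to T\times\Delta^*$ be protocols, with $(S,\delta_1,s)$ a productive reduction from $\mu$ to $\nu$ and $\delta_2$ productive with respect to i.i.d. $\nu$-distributed input, and $t\in T$. Then for all $\alpha\in\Sigma^\omega$ outside a $\mu$-null set, both $(\delta_1\circ\delta_2)^\omega((s,t),\alpha)$ and $\delta_2^\omega(t,\delta_1^\omega(s,\alpha))$ are defined and they are equal.
   Context: A protocol $\delta:S\times\Sigma\to S\times\Gamma^*$ is extended to $S\times\Sigma^*$ by $\delta(s,\varepsilon)=(s,\varepsilon)$, $\delta(s,ax)=(u,yz)$ where $(t,y)=\delta(s,a)$, $(u,z)=\delta(t,x)$. For $\alpha\in\Sigma^\omega$ with length-$n$ prefix $\alpha_n$, $\delta^\omega(s,\alpha)$ is the infinite word whose prefixes are the prefixes of the outputs (second components) of $\delta(s,\alpha_n)$, defined only when these outputs have unbounded length. The sequential composition $\delta_1\circ\delta_2:(S\times T)\times\Sigma\to(S\times T)\times\Delta^*$ is $(\delta_1\circ\delta_2)((s,t),a)=((u,v),z)$ where $(u,y)=\delta_1(s,a)$ and $(v,z)=\delta_2(t,y)$ (with $\delta_2$ extended to strings). Streams in $\Sigma^\omega$ have i.i.d. letters of law $\mu$. Productive: from every state the expected number of input letters read before an output letter is produced is finite. Reduction from $\mu$ to $\nu$: for every $y\in\Gamma^*$, $\Pr_\alpha(y\text{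 is a prefix of }\delta^\omega(s,\alpha))=\nu(y_1)\cdots\nu(y_{|y|})$. *)

(* Defs.v *)
From HB Require Import structures.
From mathcomp Require Import all_boot all_order all_algebra.
From mathcomp Require Import all_classical all_reals all_analysis.

Set Implicit Arguments.
Unset Strict Implicit.
Unset Printing Implicit Defensive.

Import Order.TTheory GRing.Theory Num.Theory.

Local Open Scope classical_set_scope.
Local Open Scope ring_scope.

Definition protocol (S : Type) (A B : Type) := S * A -> S * seq B.

Fixpoint run (S A B : Type) (delta : protocol S A B) (s : S) (w : seq A)
    : S * seq B :=
  if w is a :: x then
    let: (t, y) := delta (s, a) in
    let: (u, z) := run delta t x in
    (u, y ++ z)
  else (s, [::]).

Definition scomp (S T A B C : Type) (delta1 : protocol S A B)
    (delta2 : protocol T B C) : protocol (S * T) A C :=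
  fun '((s, t), a) =>
    let: (u, y) := delta1 (s, a) in
    let: (v, z) := run delta2 t y in
    ((u, v), z).

Definition output (S A B : Type) (delta : protocol S A B) (s : S)
    (alpha : nat -> A) (n : nat) : seq B := (run delta s (mkseq alpha n)).2.

Definition stream_prefix (B : Type) (y : seq B) (beta : nat -> B) : Prop :=
  mkseq beta (size y) = y.

Definition is_omega (S : Type) (A : Type) (B : eqType) (delta : protocol S A B)
    (s : S) (alpha : nat -> A) (beta : nat -> B) : Prop :=
  forall y : seq B,
    stream_prefix y beta <-> exists n, prefix y (output delta s alpha n).

(* The partial function delta^omega; [omegaE] and [omega_defined] below
   determine its graph and its domain. *)
Definition omega (S : Type) (A : Type) (B : eqType) (delta : protocol S A B)
    (s : S) (alpha : nat -> A) : option (nat -> B) :=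
  if pselect (exists beta, is_omega delta s alpha beta) is left e
  then Some (sval (cid e)) else None.

Section omega_theory.
Variables (S A : Type) (B : eqType) (delta : protocol S A B).
Implicit Types (s : S) (alpha : nat -> A) (beta : nat -> B).

Lemma stream_prefix_mkseq beta n : stream_prefix (mkseq beta n) beta.
Proof. by rewrite /stream_prefix size_mkseq. Qed.

Lemma is_omega_inj s alpha beta beta' :
  is_omega delta s alpha beta -> is_omega delta s alpha beta' -> beta = beta'.
Proof.
move=> h h'; apply/funext => i.
have := (h' (mkseq beta i.+1)).2 ((h _).1 (stream_prefix_mkseq _ _)).
rewrite /stream_prefix size_mkseq => /(congr1 (nth (beta i) ^~ i)).
by rewrite !nth_mkseq.
Qed.

Lemma omegaE s alpha beta :
  omega delta s alpha = Some beta <-> is_omega delta s alpha beta.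
Proof.
rewrite /omega; case: pselect => [e|ne]; last first.
  by split=> // h; case: ne; exists beta.
split=> [[<-]|h]; first exact: (svalP (cid e)).
by congr Some; apply: is_omega_inj (svalP (cid e)) h.
Qed.

Lemma run_cat s w w' :
  run delta s (w ++ w') =
  ((run delta (run delta s w).1 w').1,
   (run delta s w).2 ++ (run delta (run delta s w).1 w').2).
Proof.
elim: w s => [|a w IH] s /=; first by case: run.
by case: (delta _) => t y; rewrite IH; case: (run delta t w) => u z /=;
  rewrite catA.
Qed.

Lemma output_prefix s alpha m n :
  (m <= n)%N -> prefix (output delta s alpha m) (output delta s alpha n).
Proof.
move=> mn; rewrite /output -(subnKC mn) /mkseq iotaD map_cat run_cat /=.
exact: prefix_prefix.
Qed.

Lemma omega_defined s alpha :
  omega delta s alpha <-> forall k, exists n,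
    (k <= size (output delta s alpha n))%N.
Proof.
split=> [|unb].
  case E: omega => [beta|//] _ k; have /omegaE h := E.
  have [n /size_prefix] := (h _).1 (stream_prefix_mkseq beta k).
  by rewrite size_mkseq => kn; exists n.
suff [beta /omegaE ->] : exists beta, is_omega delta s alpha beta by [].
have [m hm] := choice unb.
have b0 : B by have := hm 1%N; case: output.
pose beta i := nth b0 (output delta s alpha (m i.+1)) i.
have betaE n i : (i < size (output delta s alpha n))%N ->
    nth b0 (output delta s alpha n) i = beta i.
  move=> ilt; rewrite /beta; have ilt' := hm i.+1.
  have [/(output_prefix s alpha)|/ltnW/(output_prefix s alpha)] :=
    leqP n (m i.+1); move=> /prefixP[z ->]; by rewrite nth_cat ?ilt ?ilt'.
exists beta => y; split=> [yb|[n /prefixP[z e]]].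
  exists (m (size y)); apply/prefixP.
  exists (drop (size y) (output delta s alpha (m (size y)))).
  rewrite -{1}[LHS](cat_take_drop (size y)); congr (_ ++ _).
  rewrite -[RHS]yb; apply: (@eq_from_nth _ b0).
    by rewrite size_takel ?hm// size_mkseq.
  move=> i; rewrite size_takel ?hm// => ilt.
  by rewrite nth_take// nth_mkseq// betaE// (leq_trans ilt).
apply: (@eq_from_nth _ b0); rewrite ?size_mkseq// => i ilt.
by rewrite nth_mkseq// -(betaE n) e ?nth_cat ?ilt// size_cat ltn_addr.
Qed.

End omega_theory.

Record distr (R : realType) (A : finType) := Distr {
  pmf :> A -> R;
  pmf_ge0 : forall a, 0 <= pmf a;
  pmf_sum1 : \sum_(a : A) pmf a = 1 }.

Lemma distr_inhabited (R : realType) (A : finType) (mu : distr R A) :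
  exists a : A, true.
Proof.
case: (pickP (@predT A)) => [a _|A0]; first by exists a.
by have /eqP := pmf_sum1 mu; rewrite big_pred0// eq_sym oner_eq0.
Qed.

(* The measurable structure on a generated sigma-algebra needs a pointed
   carrier; [mu] supplies the point. *)
Definition stream (R : realType) (A : finType) (mu : distr R A) : Type :=
  nat -> A.

HB.instance Definition _ (R : realType) (A : finType) (mu : distr R A) :=
  Choice.copy (stream mu) (nat -> A).
HB.instance Definition _ (R : realType) (A : finType) (mu : distr R A) :=
  isPointed.Build (stream mu) (fun=> xchoose (distr_inhabited mu)).

Definition cylinders (R : realType) (A : finType) (mu : distr R A)
    : set (set (stream mu)) :=
  [set [set alpha : stream mu | stream_prefix w alpha] | w in @setT (seq A)].
Arguments cylinders {R A} mu _.

Definition stream_space (R : realType) (A : finType) (mu : distr R A)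
    : measurableType (cylinders mu).-sigma :=
  g_sigma_algebraType (cylinders mu).

(* The letters are i.i.d. of law [mu]: this characterizes the product measure
   among the probabilities on the cylinder sigma-algebra. *)
Definition iid (R : realType) (A : finType) (mu : distr R A)
    (P : probability (stream_space mu) R) : Prop :=
  forall w : seq A,
    P [set alpha | stream_prefix w alpha] = (\prod_(a <- w) mu a)%:E.

(* The infimum is +oo when no letter is ever output. *)
Definition waiting_time (R : realType) (S A B : Type) (delta : protocol S A B)
    (s : S) (alpha : nat -> A) : \bar R :=
  ereal_inf [set n%:R%:E | n in [set n | (0 < size (output delta s alpha n))%N]].

Definition productive (R : realType) (S B : Type) (A : finType)
    (mu : distr R A) (P : probability (stream_space mu) R)
    (delta : protocol S A B) : Prop :=
  forall s : S, (\int[P]_alpha waiting_time R delta s alpha < +oo)%E.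

Definition reduction (R : realType) (S : Type) (A B : finType)
    (mu : distr R A) (P : probability (stream_space mu) R) (nu : distr R B)
    (delta : protocol S A B) (s : S) : Prop :=
  forall y : seq B,
    P [set alpha | exists2 beta, omega delta s alpha = Some beta
                               & stream_prefix y beta]
    = (\prod_(b <- y) nu b)%:E.

(* Main.v *)
(* By Markov's inequality, productivity makes the probability that a protocol is
   silent on the first n letters tend to 0, from every state.  A stream on which
   the output stays bounded is silent for ever after some finite word w; since
   the letters following w are again i.i.d. and there are countably many w,
   such streams form a null set.  This argument only uses the probabilities of
   the prefix events, so it applies as well to the random stream
   [omega delta1 s alpha], whose prefixes have law nu because delta1 is a
   reduction.  Hence both maps are almost surely defined, and they agree
   because the composition reads alpha letter by letter and outputs
   [run delta2] of the output of delta1. *)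

Require Import Defs.
From mathcomp Require Import all_boot all_order all_algebra.
From mathcomp Require Import all_classical all_reals all_analysis.
From mathcomp Require Import measurable_realfun.

Set Implicit Arguments.
Unset Strict Implicit.
Unset Printing Implicit Defensive.

Import Order.TTheory GRing.Theory Num.Theory.

Local Open Scope classical_set_scope.
Local Open Scope ring_scope.

(** * Composition and silence on a fixed stream *)

Lemma run_scomp (S T A B : Type) (C : eqType) (delta1 : protocol S A B)
    (delta2 : protocol T B C) s t w :
  run (scomp delta1 delta2) (s, t) w =
  (((run delta1 s w).1, (run delta2 t (run delta1 s w).2).1),
   (run delta2 t (run delta1 s w).2).2).
Proof.
elim: w s t => [//|a w IH] s t /=.
case: (delta1 (s, a)) => u y; case E: (run delta2 t y) => [v z].
rewrite IH; case: (run delta1 u w) => u' y' /=.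
by rewrite run_cat E.
Qed.

Lemma prefix_run (S A : Type) (B : eqType) (delta : protocol S A B) s w w' :
  prefix (run delta s w).2 (run delta s (w ++ w')).2.
Proof. by rewrite run_cat prefix_prefix. Qed.

Lemma stream_prefix_output (S A : Type) (B : eqType) (delta : protocol S A B)
    s alpha beta n :
  is_omega delta s alpha beta -> stream_prefix (output delta s alpha n) beta.
Proof. by move=> h; apply/h; exists n; exact: prefix_refl. Qed.

(** [delta2] outputs [z] after finitely many letters of [beta], and [delta1] produces these from
    finitely many letters of [alpha]. *)
Lemma is_omega_scomp (S T A : Type) (B C : eqType) (delta1 : protocol S A B)
    (delta2 : protocol T B C) s t alpha beta gamma :
  is_omega delta1 s alpha beta -> is_omega delta2 t beta gamma ->
  is_omega (scomp delta1 delta2) (s, t) alpha gamma.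
Proof.
move=> h1 h2 z; apply: (iff_trans (h2 z)); rewrite /output.
split=> -[m zm].
  have [n /prefixP[w' nE]] := (h1 _).1 (stream_prefix_mkseq beta m).
  exists n; rewrite run_scomp /= (prefix_trans zm)//.
  by rewrite -/(output delta1 s alpha n) nE prefix_run.
(* What [delta1] has output so far is itself the prefix of [beta] of that length. *)
exists (size (output delta1 s alpha m)).
by rewrite (stream_prefix_output m h1); move: zm; rewrite run_scomp.
Qed.

Lemma mkseqD (A : Type) (beta : nat -> A) m n :
  mkseq beta (m + n) = mkseq beta m ++ mkseq (fun i => beta (m + i)%N) n.
Proof.
rewrite /mkseq iotaD map_cat add0n; congr (_ ++ _).
by rewrite -{1}(addn0 m) iotaDl -map_comp.
Qed.

(* Take m such that the length of the output on the first m letters is maximal. *)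
Lemma not_omega_silent (S A : Type) (B : eqType) (delta : protocol S A B)
    s beta :
  ~ omega delta s beta -> exists m, forall n,
    (run delta (run delta s (mkseq beta m)).1
       (mkseq (fun i => beta (m + i)%N) n)).2 = [::].
Proof.
move=> /omega_defined/existsNP[k /forallNP hk].
have ubk n : (size (output delta s beta n) <= k)%N.
  by rewrite leqNgt; apply/negP => /ltnW; exact: hk.
have [m hm] : exists m, forall n,
    (size (output delta s beta n) <= size (output delta s beta m))%N.
  pose L l := `[< exists n, size (output delta s beta n) = l >].
  have Lex : exists l, L l.
    by exists (size (output delta s beta 0)); apply/asboolP; exists 0%N.
  have Lub l : L l -> (l <= k)%N by move=> /asboolP[n <-].
  case: (ex_maxnP Lex Lub) => _ /asboolP[m <-] mmax.
  by exists m => n; apply: mmax; apply/asboolP; exists n.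
exists m => n; have := hm (m + n)%N.
rewrite /output mkseqD run_cat /= size_cat -{2}(addn0 (size _)) leq_add2l.
by rewrite leqn0 => /nilP.
Qed.

(** * Events determined by finitely many letters *)

Section streams.
Context {R : realType} {A : finType} (mu : distr R A).

Definition cylinder (y : seq A) : set (stream_space mu) :=
  [set alpha | stream_prefix y alpha].

Lemma measurable_cylinder y : measurable (cylinder y).
Proof. by apply: sub_sigma_algebra; exists y. Qed.

(** There are finitely many words of length [n], so this gives measurability and, later,
    probabilities as finite sums. *)
Lemma cylinder_bigcup n (p : pred (seq A)) :
  [set alpha : stream_space mu | p (mkseq alpha n)] =
  \bigcup_(v in [set v : n.-tuple A | p v]) cylinder v.
Proof.
apply/seteqP; split=> [alpha pa|alpha [v pv]] /=.
  by exists [tuple of mkseq alpha n]; rewrite //; exact: stream_prefix_mkseq.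
by rewrite /cylinder/= /stream_prefix size_tuple => ->.
Qed.

Lemma measurable_mkseq n (p : pred (seq A)) :
  measurable [set alpha : stream_space mu | p (mkseq alpha n)].
Proof.
rewrite cylinder_bigcup; apply: fin_bigcup_measurable => // v _.
exact: measurable_cylinder.
Qed.

End streams.

(* Unlike [ge0_le_integral], this needs no measurability: it will be applied
   with g the waiting time. *)
Lemma ge0_le_integralT d (X : measurableType d) (R : realType)
    (m : {measure set X -> \bar R}) (f g : X -> \bar R) :
  (forall x, 0 <= f x)%E -> (forall x, f x <= g x)%E ->
  (\int[m]_x f x <= \int[m]_x g x)%E.
Proof.
move=> f0 fg.
have g0 x : (0 <= g x)%E by exact: le_trans (fg x).
rewrite !ge0_integralTE//; apply: le_ereal_sup => _ [h hf <-].
by exists h => // x; exact: le_trans (fg x).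
Qed.

(** * Markov's inequality for the waiting time *)

Section waiting_time.
Context {R : realType} {A : finType} {mu : distr R A}
  (Q : probability (stream_space mu) R) (S : Type) (B : eqType)
  (delta : protocol S A B).

Lemma waiting_time_ge s alpha n :
  nilp (output delta s alpha n) -> (n%:R%:E <= waiting_time R delta s alpha)%E.
Proof.
move=> nil_n; apply: le_ereal_inf_tmp => _ [m /= out_m <-].
rewrite lee_fin ler_nat leqNgt; apply/negP => /ltnW mn.
move: out_m; apply/negP; rewrite -leqNgt leqn0.
move: nil_n; rewrite /output /nilp -(subnKC mn) mkseqD run_cat size_cat.
by rewrite addn_eq0 => /andP[].
Qed.

(** The waiting time dominates [n] times the indicator of silence on the first [n] letters. *)
Lemma markov_waiting_time s n :
  (n%:R%:E * Q [set alpha | nilp (output delta s alpha n)] <=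
   \int[Q]_alpha waiting_time R delta s alpha)%E.
Proof.
have mZ := measurable_mkseq (mu := mu) n (fun w => nilp (run delta s w).2).
rewrite -[X in Q X]setIT -integral_indic// -ge0_integralZl_EFin//; last first.
  exact/measurable_EFinP/measurable_indic.
apply: ge0_le_integralT => alpha; first by rewrite mule_ge0 ?lee_fin.
rewrite indicE; have [/set_mem/=|_] := boolP (_ \in _).
  by move/waiting_time_ge; rewrite mule1.
rewrite mule0; apply: le_ereal_inf_tmp => _ [m _ <-].
by rewrite lee_fin.
Qed.

End waiting_time.

(** * Random streams with a product law on prefixes *)

Lemma prod_pmf_ge0 (R : realType) (A : finType) (mu : distr R A) w :
  0 <= \prod_(a <- w) mu a.
Proof. by apply: prodr_ge0 => a _; exact: Defs.pmf_ge0. Qed.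

(** A partially defined random stream [F] covers both the input stream ([F] is [Some]) and
    [omega delta1 s]. *)
Definition prefix_event (X A : Type) (F : X -> option (nat -> A)) (y : seq A)
    : set X :=
  [set x | exists2 beta, F x = Some beta & stream_prefix y beta].

Section random_stream.
Context d (X : measurableType d) (R : realType) (P : probability X R)
  (A : finType) (mu : distr R A) (F : X -> option (nat -> A)).

Hypothesis mF : forall y, measurable (prefix_event F y).
Hypothesis lawF : forall y, P (prefix_event F y) = (\prod_(a <- y) mu a)%:E.

Lemma measurable_prefix_event_cat w n (D : set (n.-tuple A)) :
  measurable (\bigcup_(v in D) prefix_event F (w ++ v)).
Proof. by apply: fin_bigcup_measurable => //; exact: finite_finset. Qed.

(** Distinct [v] of the same length give disjoint events, and the product law factors over
    concatenation: the letters after [w] are again i.i.d. *)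
Lemma prefix_event_cat w n (D : set (n.-tuple A)) :
  P (\bigcup_(v in D) prefix_event F (w ++ v)) =
  ((\prod_(a <- w) mu a)%:E * \sum_(v \in D) (\prod_(a <- v) mu a)%:E)%E.
Proof.
rewrite (measure_fin_bigcup _ finite_finset)//; last first.
  move=> u v _ _ [x [[beta Fx xu] [beta' Fx' xv]]]; apply: val_inj.
  move: Fx' xv; rewrite Fx => -[<-]; move: xu.
  rewrite /stream_prefix !size_cat !size_tuple => -> /eqP.
  by rewrite eqseq_cat// => /andP[_ /eqP].
rewrite ge0_mule_fsumr//; last first.
  by move=> v; rewrite lee_fin; exact: prod_pmf_ge0.
by apply: eq_fsbigr => v _; apply: (etrans (lawF _)); rewrite big_cat.
Qed.

End random_stream.

Lemma cylinderE (R : realType) (A : finType) (mu : distr R A) y :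
  cylinder (mu := mu) y = prefix_event (X := stream_space mu) Some y.
Proof.
by apply/seteqP; split=> [alpha|alpha [_ [<-]]//]; exists alpha.
Qed.

(** The multiple with [n] equal to 1 makes [x] finite; the Archimedean property then excludes a
    positive [x]. *)
Lemma ge0_bounded_multiples_eq0 (R : realType) (x y : \bar R) :
  (0 <= x)%E -> (y < +oo)%E -> (forall n, n%:R%:E * x <= y)%E -> x = 0%E.
Proof.
move=> x0 yoo xy; apply/eqP; rewrite eq_le x0 andbT leNgt; apply/negP => xgt0.
have xfin : x \is a fin_num.
  rewrite ge0_fin_numE// (le_lt_trans _ yoo)//.
  by have := xy 1%N; rewrite mul1e.
have yfin : y \is a fin_num.
  by rewrite ge0_fin_numE//; have := xy 0%N; rewrite mul0e.
move: xgt0 xy; rewrite -(fineK xfin) -(fineK yfin) lte_fin => r0 ry.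
have := ry (Num.bound (fine y / fine x)); apply/negP; rewrite -ltNge lte_fin.
rewrite -ltr_pdivrMr//; apply: archi_boundP.
have := ry 0%N; rewrite mul0e lee_fin => y0.
by rewrite divr_ge0// ltW.
Qed.

(** * Almost sure definedness of the output *)

Section omega_of_random_stream.
Context d (X : measurableType d) (R : realType) (P : probability X R)
  (A : finType) (mu : distr R A) (Q : probability (stream_space mu) R)
  (S : Type) (B : eqType) (delta : protocol S A B) (F : X -> option (nat -> A)).
Hypotheses (iidQ : iid Q) (prodQ : productive Q delta).
Hypothesis mF : forall y, measurable (prefix_event F y).
Hypothesis lawF : forall y, P (prefix_event F y) = (\prod_(a <- y) mu a)%:E.

(** For every [n] the event lies in [M n], whose probability is that of [w] times the
    [Q]-probability of silence on [n] letters; by Markov, [n] times this stays bounded. *)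
Lemma negligible_silent s w :
  P.-negligible [set x | exists beta, [/\ F x = Some beta, stream_prefix w beta &
    forall n, (run delta s (mkseq (fun i => beta (size w + i)%N) n)).2 = [::]]].
Proof.
pose Z n := [set v : n.-tuple A | nilp (run delta s v).2].
pose M n := \bigcup_(v in Z n) prefix_event F (w ++ v).
have mM n : measurable (M n) by exact: measurable_prefix_event_cat.
have mcap : measurable (\bigcap_n M n) by exact: bigcapT_measurable.
(* The same sum over silent words occurs in [P (M n)], which carries the Markov bound from [Q] over
   to [P]. *)
have QZ n : Q [set alpha | nilp (output delta s alpha n)] =
    (\sum_(v \in Z n) (\prod_(a <- v) mu a)%:E)%E.
  rewrite (cylinder_bigcup mu n (fun v => nilp (run delta s v).2)).
  under eq_bigcupr do rewrite cylinderE.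
  rewrite (@prefix_event_cat _ _ _ Q _ mu Some _ _ [::]) ?big_nil ?mul1e//.
    by move=> y; rewrite -cylinderE; exact: measurable_cylinder.
  by move=> y; rewrite -cylinderE; exact: iidQ.
exists (\bigcap_n M n); split => //.
  apply: (@ge0_bounded_multiples_eq0 _ _ ((\prod_(a <- w) mu a)%:E *
    \int[Q]_alpha waiting_time R delta s alpha)%E) => [//||n].
    apply: lte_mul_pinfty => //.
    by rewrite lee_fin; exact: prod_pmf_ge0.
  apply: (@le_trans _ _ (n%:R%:E * P (M n))%E).
    by rewrite lee_wpmul2l ?lee_fin// le_measure ?inE//; exact: bigcap_inf.
  rewrite (prefix_event_cat mF lawF) -QZ muleCA lee_wpmul2l//.
    by rewrite lee_fin; exact: prod_pmf_ge0.
  exact: markov_waiting_time.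
move=> x [beta [Fx wbeta sil]] n _.
exists [tuple of mkseq (fun i => beta (size w + i)%N) n].
  by rewrite /Z /= sil.
by exists beta => //=; rewrite /stream_prefix size_cat size_mkseq mkseqD wbeta.
Qed.

Lemma ae_omega_defined s :
  {ae P, forall x beta, F x = Some beta -> omega delta s beta}.
Proof.
pose N w := [set x | exists beta, [/\ F x = Some beta, stream_prefix w beta &
  forall n, (run delta (run delta s w).1
               (mkseq (fun i => beta (size w + i)%N) n)).2 = [::]]].
(* Finite words are countable: [k] runs over their codes, and a number that codes no word
   contributes the empty set. *)
have negN : P.-negligible (\bigcup_k (oapp N set0 (unpickle k))).
  apply: negligible_bigcup => k; case: unpickle => [w|] /=.
    exact: negligible_silent.
  exact: negligible_set0.
apply: (negligibleS _ negN) => x /existsNP[beta].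
move=> /not_implyP[Fx ndef]; have [m sil] := not_omega_silent ndef.
exists (pickle (mkseq beta m)) => //; rewrite pickleK /=.
by exists beta; rewrite size_mkseq; split => //; exact: stream_prefix_mkseq.
Qed.

End omega_of_random_stream.

(** Definedness means unbounded output; given this, [y] need only be a prefix of some finite output.
    Both are countable combinations of events about finitely many letters. *)
Lemma measurable_omega_prefix (R : realType) (A : finType) (mu : distr R A)
    (S : Type) (B : eqType) (delta : protocol S A B) s y :
  measurable (prefix_event (fun alpha : stream_space mu => omega delta s alpha) y).
Proof.
rewrite [X in measurable X](_ : _ =
  (\bigcap_k \bigcup_n [set alpha : stream_space mu |
     (k <= size (run delta s (mkseq alpha n)).2)%N]) `&`
  \bigcup_n [set alpha : stream_space mu |
     prefix y (run delta s (mkseq alpha n)).2]).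
  apply: measurableI.
    apply: bigcapT_measurable => k; apply: bigcupT_measurable => n.
    exact: (measurable_mkseq (mu := mu) n (fun w => k <= size (run delta s w).2)%N).
  apply: bigcupT_measurable => n.
  exact: (measurable_mkseq (mu := mu) n (fun w => prefix y (run delta s w).2)).
apply/seteqP; split=> [alpha [beta om yb]|alpha [unb [n _ yn]]].
  split; last by have [n] := ((omegaE _ _ _ _).1 om y).1 yb; exists n.
  move=> k _; have /omega_defined/(_ k)[n kn] : omega delta s alpha by rewrite om.
  by exists n.
have : omega delta s alpha.
  by apply/omega_defined => k; have [m] := unb k I; exists m.
case om: (omega delta s alpha) => [beta|//] _; exists beta => //.
by apply/((omegaE _ _ _ _).1 om); exists n.
Qed.

Theorem theorem1 (R : realType) (Sigma Gamma Delta : finType)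
    (mu : distr R Sigma) (nu : distr R Gamma)
    (P : probability (stream_space mu) R) (Q : probability (stream_space nu) R)
    (iidP : iid P) (iidQ : iid Q)
    (S T : Type)
    (delta1 : protocol S Sigma Gamma) (delta2 : protocol T Gamma Delta)
    (s : S) (t : T)
    (prod1 : productive P delta1) (red1 : reduction P nu delta1 s)
    (prod2 : productive Q delta2) :
  {ae P, forall alpha : stream_space mu, exists gamma : nat -> Delta,
     omega (scomp delta1 delta2) (s, t) alpha = Some gamma /\
     obind (omega delta2 t) (omega delta1 s alpha) = Some gamma}.
Proof.
(* The input itself is a random stream with prefix law [mu]. *)
have def1 : {ae P, forall (alpha : stream_space mu) beta, Some alpha = Some beta ->
    omega delta1 s beta}.
  apply: (ae_omega_defined (mu := mu) iidP prod1) => y.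
    by rewrite -cylinderE; exact: measurable_cylinder.
  by rewrite -cylinderE; exact: iidP.
(* By [red1] the prefixes of [omega delta1 s] have law [nu], so the same lemma applies to [delta2],
   with [Q] bounding the probability of silence. *)
have def2 : {ae P, forall (alpha : stream_space mu) beta,
    omega delta1 s alpha = Some beta -> omega delta2 t beta}.
  apply: (ae_omega_defined iidQ prod2) => y.
    exact: measurable_omega_prefix.
  exact: red1.
apply: filterS2 def1 def2 => alpha /(_ _ erefl) + om2.
case om1: (omega delta1 s alpha) om2 => [beta|//] /(_ _ erefl) + _ /=.
case om2: (omega delta2 t beta) => [gamma|//] _; exists gamma; split=> //.
by apply/omegaE; apply: is_omega_scomp; apply/omegaE; eassumption.
Qed.
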